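(* Let $n\ge 1$, $a_1,\dots,a_n\in\mathbb D$, $\epsilon\in\mathbb T$, and $B(z)=\epsilon\prod_{k=1}^n\frac{z-a_k}{1-\overline{a_k}z}$. Let $R=\min_{1\le k\le n}1/|a_k|$ and $\mathbb D_R=\{z\in\mathbb C:|z|<R\}$. Let $K$ be the set of critical values of $B$, and let $\Gamma\subset\mathbb D_R$ be a simple smooth curve with $\Gamma\cap K=\emptyset$. Then there exist numbers $r_0>0$ and $r_1>0$ such that for any initial solution $B(z_0)=w_0$ with $|z_0|\le 1$ and $w_0\in\Gamma$, and for any $w\in K_{r_1}(w_0)\cap\Gamma$, there exists a unique $z\in K_{r_0}(z_0)$ with $|z|\le 1$ and $B(z)=w$; this $z$ is the limit $z=\lim_{j\to\infty}z_j$ of the quadratically convergent sequence starting from $z_0$ and given by $$z_{j+1}=g(z_j)\quad(j=0,1,2,\dots),\qquad g(\zeta)=g_w(\zeta)=\zeta-\frac{B(\zeta)-w}{B'(\zeta)}\quad(\zeta\in K_{r_0}(z_0)).$$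
   Context: $\mathbb D=\{z\in\mathbb C:|z|<1\}$, $\mathbb T=\{z\in\mathbb C:|z|=1\}$. In the definition of $R$, $1/0$ is read as $\infty$. For $c\in\mathbb C$ and $\rho>0$, $K_\rho(c)=\{z\in\mathbb C:|z-c|<\rho\}$ (not to be confused with the set $K$). The set of critical points of $B$ is $A'=\{b\in\mathbb C:B'(b)=0\}$, and $K=B(A')=\{B(b):b\in A'\}$ is the set of critical values. Quadratic convergence of $z_j\to z$ means that there is a constant $C$ with $|z_{j+1}-z|\le C|z_j-z|^2$ for all $j$.
   Formalization: The condition |z|≤1 on the solution is asserted only when |w|≤1, since for |w|>1 no z with |z|≤1 satisfies B(z)=w (e.g. B(z)=z, Γ=[0,2], z_0=1); existence, uniqueness in K_{r_0}(z_0) and quadratic convergence are asserted for every w in K_{r_1}(w_0)∩Γ. *)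

(* Defs.v *)
From mathcomp Require Import all_boot all_order all_algebra.
From mathcomp Require Export complex.
From mathcomp Require Import all_classical all_reals all_analysis.
Import Order.TTheory GRing.Theory Num.Theory numFieldNormedType.Exports.

Set Implicit Arguments.
Unset Strict Implicit.
Unset Printing Implicit Defensive.

Local Open Scope classical_set_scope.
Local Open Scope ring_scope.

(* [R[i]] carries no topology of its own in MathComp-Analysis; seen as an
   element of [numClosedFieldType] it inherits the norm topology of a numeric
   field. Norms take their values in [cplx R], so that a real bound [r] appears
   as [r%:C]. *)
Definition cplx (R : realType) : numClosedFieldType := R[i].

Section Definitions.
Context {R : realType}.
Local Notation C := (cplx R).

Definition disc (c : C) (rho : R) : set C := [set z | `|z - c| < rho%:C%C].

(* A simple smooth curve is the image of a compact parameter interval [a, b]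
   under a C^1 map with nowhere vanishing derivative (one-sided at a and b)
   which is injective, except that the curve may be closed. *)
Definition simple_smooth_curve (Gamma : set C) : Prop :=
  exists (a b : R) (gamma gamma' : R -> C),
    [/\ a < b,
        Gamma = gamma @` `[a, b],
        forall t, t \in `[a, b] ->
          (gamma s - gamma t) / ((s - t)%:C%C : C)
            @[s --> within `[a, b] t^'] --> gamma' t,
        {within `[a, b], continuous gamma'} &
        (forall t, t \in `[a, b] -> gamma' t != 0) /\
        (forall s t, s \in `[a, b] -> t \in `[a, b] -> gamma s = gamma t ->
          [\/ s = t, s = a /\ t = b | s = b /\ t = a])].

Section Blaschke.
Variables (n : nat) (a : 'I_n -> C) (eps : C).

Definition blaschke (z : C) : C :=
  eps * \prod_(k < n) ((z - a k) / (1 - (a k)^* * z)).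

(* At a pole [blaschke] takes a junk value, since x / 0 = 0. *)
Definition pole_free (z : C) : Prop := forall k, 1 - (a k)^* * z != 0.

(* [0^-1 = +oo] in [\bar R]. *)
Definition pole_radius : \bar R :=
  \big[Order.min/+oo%E]_(k < n) ((complex.Re `|a k|)%:E^-1)%E.

Definition pole_free_disc : set C :=
  [set z | ((complex.Re `|z|)%:E < pole_radius)%E].

Definition critical_points : set C :=
  [set b | pole_free b /\ derive1 blaschke b = 0].

Definition critical_values : set C := blaschke @` critical_points.

Definition newton (w zeta : C) : C :=
  zeta - (blaschke zeta - w) / derive1 blaschke zeta.

End Blaschke.

Definition quadratically_convergent (u : nat -> C) (z : C) : Prop :=
  u @ \oo --> z /\
  exists M : R, forall j, `|u j.+1 - z| <= (M%:C%C : C) * `|u j - z| ^+ 2.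

End Definitions.

(* Main.v *)
(* On a disc [D] slightly larger than the closed unit disc the denominators
   [1 - conj (a_k) z] stay away from 0, so [B] has there a uniform expansion
   [|B x - B y - B' y (x - y)| <= M |x - y|^2].  The set of [z] in the closed
   unit disc with [B z] in [Gamma] is compact and contains no critical point,
   hence [|B'| >= m > 0] on it.  The constants [M], [m] and the margin of
   [D] alone determine a radius [r0] on which [B] is injective and a bound [r1] on
   the initial residual under which each Newton step at least halves the residual;
   the iterates then form a Cauchy sequence inside the disc of radius [r0], with
   quadratic convergence.  Finally [|B z| > 1] for [|z| > 1] because every Moebius factor
   has modulus [> 1] there. *)
Require Import Defs.
From mathcomp Require Import all_boot all_order all_algebra.
From mathcomp Require Import all_classical all_reals all_analysis.
From mathcomp Require Import ring lra.
Import Order.TTheory GRing.Theory Num.Theory numFieldNormedType.Exports.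

Set Implicit Arguments.
Unset Strict Implicit.
Local Open Scope classical_set_scope.
Local Open Scope ring_scope.

Section ComplexNorm.
Context {R : realType}.
Local Notation C := (cplx R).
Implicit Types x y z : C.

(* [`|z|] lies in [cplx R], whose order is partial; [cnorm] moves the estimates
   to [R], where [lra] applies. *)
Definition cnorm (z : C) : R := complex.Re `|z|.

Lemma cnormE z : `|z| = (cnorm z)%:C%C.
Proof. by rewrite /cnorm [`|z|]normc_def. Qed.

Lemma cnorm_ge0 z : 0 <= cnorm z.
Proof. by rewrite -lecR -cnormE normr_ge0. Qed.

Lemma cnormM x y : cnorm (x * y) = cnorm x * cnorm y.
Proof. by apply: complexI; rewrite rmorphM /= -!cnormE normrM. Qed.

Lemma cnormV x : cnorm x^-1 = (cnorm x)^-1.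
Proof. by apply: complexI; rewrite fmorphV /= -!cnormE normfV. Qed.

Lemma cnormN x : cnorm (- x) = cnorm x.
Proof. by apply: complexI; rewrite -!cnormE normrN. Qed.

Lemma cnormB x y : cnorm (x - y) = cnorm (y - x).
Proof. by rewrite -cnormN opprB. Qed.

Lemma cnorm0 : cnorm 0 = 0.
Proof. by apply: complexI; rewrite -!cnormE normr0. Qed.

Lemma cnorm1 : cnorm 1 = 1.
Proof. by apply: complexI; rewrite -!cnormE normr1. Qed.

Lemma cnorm_conj x : cnorm x^* = cnorm x.
Proof. by apply: complexI; rewrite -!cnormE norm_conjC. Qed.

Lemma cnorm_eq0 x : (cnorm x == 0) = (x == 0).
Proof. by rewrite -[RHS]normr_eq0 cnormE -(inj_eq (@complexI R)). Qed.

Lemma cnorm_gt0 x : (0 < cnorm x) = (x != 0).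
Proof. by rewrite lt0r cnorm_eq0 cnorm_ge0 andbT. Qed.

Lemma cnorm_triangle x y : cnorm (x + y) <= cnorm x + cnorm y.
Proof. by rewrite -lecR rmorphD /= -!cnormE ler_normD. Qed.

Lemma cnorm_distD z x y : cnorm (x - y) <= cnorm (x - z) + cnorm (z - y).
Proof. by rewrite -{1}[x](subrK z) -addrA cnorm_triangle. Qed.

Lemma cnorm_lerB x y : cnorm x - cnorm y <= cnorm (x - y).
Proof. by have := cnorm_triangle (x - y) y; rewrite subrK; lra. Qed.

Lemma cnorm_def (u v : R) : cnorm (u +i* v)%C = Num.sqrt (u ^+ 2 + v ^+ 2).
Proof. by rewrite /cnorm [`|_|]normc_def. Qed.

Lemma cnorm_real (r : R) : cnorm (r%:C%C : C) = `|r|.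
Proof. by rewrite cnorm_def expr0n addr0 sqrtr_sqr. Qed.

Lemma disc_cnorm z (rho : R) x : disc z rho x <-> cnorm (x - z) < rho.
Proof. by rewrite /disc /= cnormE ltcR. Qed.

Lemma gt0_cplx (e : C) : 0 < e -> exists2 r : R, 0 < r & e = r%:C%C.
Proof.
case: e => u v; rewrite ltcE /= => /andP[/eqP -> u0].
by exists u.
Qed.

Lemma nbhs_cnormP x (P : set C) :
  nbhs x P <-> exists2 r : R, 0 < r & forall y, cnorm (y - x) < r -> P y.
Proof.
split => [/nbhs_ballP[e /gt0_cplx[r r0 ->]] sP|[r r0 sP]].
  exists r => // y yx; apply: sP.
  by rewrite -ball_normE /ball_ /= cnormE ltcR cnormB.
apply/nbhs_ballP; exists r%:C%C; first by rewrite /= ltcR.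
by move=> y; rewrite -ball_normE /ball_ /= cnormE ltcR cnormB; exact: sP.
Qed.

Lemma cvg_cnormP {T : Type} (F : set_system T) (FF : Filter F) (f : T -> C) x :
  f @ F --> x <->
  forall e : R, 0 < e -> \forall t \near F, cnorm (f t - x) < e.
Proof.
split => [fx e e0|H].
  by apply: (fx [set y | cnorm (y - x) < e]); apply/nbhs_cnormP; exists e.
move=> A /nbhs_cnormP[r r0 sA].
by apply: filterS (H r r0) => t; exact: sA.
Qed.

Lemma compact_cdisc (rho : R) : compact [set z : C | cnorm z <= rho].
Proof.
pose h (p : R * R) : C := (p.1 +i* p.2)%C.
have hc : continuous h.
  move=> p; apply/cvg_cnormP => e e0.
  near=> q.
  have -> : h q - h p = (q.1 - p.1)%:C%C + 'i%C * (q.2 - p.2)%:C%C.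
    by rewrite /h; simpc.
  apply: le_lt_trans (cnorm_triangle _ _) _.
  rewrite cnormM !cnorm_real.
  have -> : cnorm ('i%C : C) = 1.
    by rewrite cnorm_def expr0n expr1n add0r sqrtr1.
  rewrite mul1r (splitr e); apply: ltrD; rewrite distrC; near: q.
    have /cvgr_dist_lt : fst q @[q --> p] --> p.1 by exact: cvg_fst.
    by apply; rewrite divr_gt0.
  have /cvgr_dist_lt : snd q @[q --> p] --> p.2 by exact: cvg_snd.
  by apply; rewrite divr_gt0.
have cK : compact (h @` (`[- rho, rho] `*` `[- rho, rho])).
  apply: continuous_compact; last by apply: compact_setX; exact: segment_compact.
  by apply: continuous_subspaceT => x; exact: hc.
apply: subclosed_compact cK _.
  move=> z zc; rewrite /= leNgt; apply/negP => lt.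
  have [] := zc [set y | rho < cnorm y].
    apply/nbhs_cnormP; exists (cnorm z - rho); first by lra.
    by move=> y yz; have := cnorm_lerB z y; rewrite cnormB /=; lra.
  by move=> y [/= ? ?]; lra.
case=> u v /= uv; exists (u, v) => //=.
have hu : `|u| <= rho.
  apply: le_trans uv; rewrite cnorm_def.
  by rewrite -sqrtr_sqr ler_sqrt ?lerDl ?addr_ge0 ?sqr_ge0.
have hv : `|v| <= rho.
  apply: le_trans uv; rewrite cnorm_def.
  by rewrite -sqrtr_sqr ler_sqrt ?lerDr ?addr_ge0 ?sqr_ge0.
by rewrite /= !in_itv /= -!ler_norml hu hv.
Unshelve. all: by end_near. Qed.

Lemma closed_cnormP (A : set C) z : closed A -> ~ A z ->
  exists2 e : R, 0 < e & forall y, cnorm (y - z) < e -> ~ A y.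
Proof.
move=> cA nA; have /nbhs_cnormP : nbhs z (~` A).
  by apply: open_nbhs_nbhs; split => //; exact: closed_openC.
by case=> r r0 h; exists r.
Qed.

Lemma simple_smooth_curve_closed (Gamma : set C) :
  simple_smooth_curve Gamma -> closed Gamma.
Proof.
case=> a [b] [g] [g'] [ab -> gd _ _].
apply: compact_closed; first exact: norm_hausdorff.
apply: continuous_compact; last exact: segment_compact.
apply/subspace_continuousP => t tab; apply/cvg_cnormP => e e0.
have /cvg_cnormP /(_ _ ltr01) H := gd t tab.
have {}H : \forall s \near t, s != t -> s \in `[a, b] ->
    cnorm ((g s - g t) / ((s - t)%:C%C : C) - g' t) < 1 by exact: H.
set G := cnorm (g' t) + 1.
have G0 : 0 < G by rewrite /G; have := cnorm_ge0 (g' t); lra.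
have eG0 : 0 < e / G by exact: divr_gt0.
suff : \forall s \near t, s \in `[a, b] -> cnorm (g s - g t) < e by exact.
near=> s => sab.
have [->|st] := eqVneq s t; first by rewrite subrr cnorm0.
have st' : `|s - t| > 0 by rewrite normr_gt0 subr_eq0.
have q : cnorm ((g s - g t) / ((s - t)%:C%C : C)) < G.
  have := cnorm_distD (g' t) ((g s - g t) / ((s - t)%:C%C : C)) 0.
  rewrite !subr0.
  suff : cnorm ((g s - g t) / ((s - t)%:C%C : C) - g' t) < 1 by rewrite /G; lra.
  by move: st sab; near: s.
move: q; rewrite cnormM cnormV cnorm_real ltr_pdivrMr // => q.
apply: lt_le_trans q _.
have : `|s - t| <= e / G by rewrite distrC ltW.
by rewrite ler_pdivlMr // mulrC.
Unshelve. all: by end_near. Qed.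

End ComplexNorm.

Section QuadDiff.
Context {R : realType}.
Local Notation C := (cplx R).

(* Uniform first-order Taylor expansion with quadratic remainder. Unlike
   bounds on a second derivative, it needs no convexity of [D]. *)
Record quad_diff (D : set C) (f f' : C -> C) (M : R) : Prop := QuadDiff {
  qd_gt0 : 0 < M;
  qd_bnd : forall x, D x -> cnorm (f x) <= M;
  qd_bnd' : forall x, D x -> cnorm (f' x) <= M;
  qd_lip : forall x y, D x -> D y -> cnorm (f x - f y) <= M * cnorm (x - y);
  qd_quad : forall x y, D x -> D y ->
    cnorm (f x - f y - f' y * (x - y)) <= M * cnorm (x - y) ^+ 2 }.

Lemma quad_diff_cst (D : set C) (c : C) : exists f' M, quad_diff D (fun=> c) f' M.
Proof.
exists (fun=> 0), (cnorm c + 1); have c0 := cnorm_ge0 c.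
have s0 x y : 0 <= (cnorm c + 1) * cnorm (x - y) ^+ 2.
  by rewrite mulr_ge0 ?exprn_ge0 ?cnorm_ge0 //; lra.
split => [|x _|x _|x y _ _|x y _ _].
- lra.
- lra.
- rewrite cnorm0; lra.
- rewrite subrr cnorm0 mulr_ge0 ?cnorm_ge0 //; lra.
- by rewrite subrr mul0r subrr cnorm0 s0.
Qed.

Lemma quad_diffM (D : set C) (f f' g g' : C -> C) (M N : R) :
  quad_diff D f f' M -> quad_diff D g g' N ->
  quad_diff D (fun x => f x * g x) (fun x => f' x * g x + f x * g' x)
    (3 * (M * N)).
Proof.
move=> [M0 fb fb' fl fq] [N0 gb gb' gl gq].
have MN0 : 0 < M * N by exact: mulr_gt0.
have pm (u v : C) (a b : R) :
    cnorm u <= a -> cnorm v <= b -> cnorm (u * v) <= a * b.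
  by move=> ua vb; rewrite cnormM ler_pM ?cnorm_ge0.
split => [|x Dx|x Dx|x y Dx Dy|x y Dx Dy].
- by rewrite mulr_gt0.
- have := pm _ _ _ _ (fb x Dx) (gb x Dx); lra.
- have := cnorm_triangle (f' x * g x) (f x * g' x).
  have := pm _ _ _ _ (fb' x Dx) (gb x Dx).
  by have := pm _ _ _ _ (fb x Dx) (gb' x Dx); lra.
- have -> : f x * g x - f y * g y = f x * (g x - g y) + (f x - f y) * g y by ring.
  have := cnorm_triangle (f x * (g x - g y)) ((f x - f y) * g y).
  have := pm _ _ _ _ (fb x Dx) (gl x y Dx Dy).
  have := pm _ _ _ _ (fl x y Dx Dy) (gb y Dy).
  have : 0 <= M * N * cnorm (x - y) by rewrite mulr_ge0 ?cnorm_ge0 // ltW.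
  lra.
- set A := f x * (g x - g y - g' y * (x - y)).
  set B := g y * (f x - f y - f' y * (x - y)).
  set E := (f x - f y) * (g' y * (x - y)).
  have -> : f x * g x - f y * g y - (f' y * g y + f y * g' y) * (x - y) =
      A + B + E.
    by rewrite /A /B /E; ring.
  have := cnorm_triangle (A + B) E; have := cnorm_triangle A B.
  have : cnorm A <= M * (N * cnorm (x - y) ^+ 2).
    by apply: (pm); [exact: fb|exact: gq].
  have : cnorm B <= N * (M * cnorm (x - y) ^+ 2).
    by apply: (pm); [exact: gb|exact: fq].
  have : cnorm E <= (M * cnorm (x - y)) * (N * cnorm (x - y)).
    by apply: (pm); [exact: fl|apply: (pm) => //; exact: gb'].
  lra.
Qed.

Lemma quad_diff_prod (I : Type) (s : seq I) (D : set C) (F : I -> C -> C) :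
  (forall i, exists f' M, quad_diff D (F i) f' M) ->
  exists f' M, quad_diff D (fun x => \prod_(i <- s) F i x) f' M.
Proof.
move=> FD; elim: s => [|i s [g' [N gN]]].
  have -> : (fun x => \prod_(i <- [::]) F i x) = fun=> 1 :> C.
    by apply/funext => x; rewrite big_nil.
  exact: quad_diff_cst.
have [f' [M fM]] := FD i.
exists (fun x => f' x * \prod_(i <- s) F i x + F i x * g' x), (3 * (M * N)).
have -> : (fun x => \prod_(j <- i :: s) F j x) =
          fun x => F i x * \prod_(j <- s) F j x.
  by apply/funext => x; rewrite big_cons.
exact: quad_diffM.
Qed.

Lemma quad_diff_lip' (D : set C) (f f' : C -> C) (M : R) x y :
  quad_diff D f f' M -> D x -> D y ->
  cnorm (f' x - f' y) <= 2 * M * cnorm (x - y).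
Proof.
move=> [M0 _ _ _ fq] Dx Dy.
have [->|xy] := eqVneq x y; first by rewrite !subrr cnorm0 mulr0.
have xy0 : 0 < cnorm (x - y) by rewrite cnorm_gt0 subr_eq0.
rewrite -(ler_pM2r xy0) -cnormM.
have -> : (f' x - f' y) * (x - y) = (f x - f y - f' y * (x - y)) +
   (f y - f x - f' x * (y - x)) by ring.
have := cnorm_triangle (f x - f y - f' y * (x - y)) (f y - f x - f' x * (y - x)).
have := fq x y Dx Dy; have := fq y x Dy Dx; rewrite (cnormB y x) expr2; lra.
Qed.

Lemma quad_diff_derive1 (D : set C) (f f' : C -> C) (M : R) x :
  quad_diff D f f' M -> nbhs x D -> derive1 f x = f' x.
Proof.
move=> [M0 _ _ _ fq] nD; have Dx := nbhs_singleton nD.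
move: nD => /nbhs_cnormP[r r0 rD].
apply: cvg_lim; first exact: norm_hausdorff.
apply/cvg_cnormP => e e0.
suff : \forall h \near nbhs (0 : C), h != 0 ->
  cnorm (h^-1 *: (f (h + x) - f x) - f' x) < e by exact.
apply/nbhs_cnormP; exists (Num.min r (e / M)).
  by rewrite lt_min r0 divr_gt0.
move=> h; rewrite subr0 lt_min => /andP[hr he] h0.
have h0' : 0 < cnorm h by rewrite cnorm_gt0.
have := fq (h + x) x; rewrite addrK => /(_ (rD _ _) Dx).
rewrite addrK => /(_ hr) q.
have -> : h^-1 *: (f (h + x) - f x) - f' x = (f (h + x) - f x - f' x * h) / h.
  by rewrite /GRing.scale /=; field.
rewrite cnormM cnormV ltr_pdivrMr //; apply: le_lt_trans q _.
by move: he; rewrite ltr_pdivlMr // expr2 mulrA ltr_pM2r // mulrC.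
Qed.

End QuadDiff.

Section Newton.
Context {R : realType}.
Local Notation C := (cplx R).

Lemma geometric_cauchy (u : nat -> C) (K : R) :
  (forall j, cnorm (u j.+1 - u j) <= K * 2^-1 ^+ j) ->
  exists z, forall j, cnorm (u j - z) <= 2 * K * 2^-1 ^+ j.
Proof.
move=> uK.
have tail k i : cnorm (u (k + i)%N - u k) <=
    2 * K * 2^-1 ^+ k - 2 * K * 2^-1 ^+ (k + i).
  elim: i => [|i IH]; first by rewrite addn0 !subrr cnorm0.
  rewrite addnS; have := cnorm_distD (u (k + i)%N) (u (k + i).+1) (u k).
  by have := uK (k + i)%N; rewrite exprS; lra.
have K0 : 0 <= K.
  by have := uK 0%N; rewrite expr0 mulr1; apply: le_trans; exact: cnorm_ge0.
have q0 j : 0 <= 2 * K * 2^-1 ^+ j by rewrite !mulr_ge0 ?exprn_ge0.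
have tail' k j : (k <= j)%N -> cnorm (u j - u k) <= 2 * K * 2^-1 ^+ k.
  by move=> kj; have := tail k (j - k)%N; rewrite subnKC //; have := q0 j; lra.
have [] := @compact_cdisc R (cnorm (u 0%N) + 2 * K) (u @ \oo) _.
  exists 0%N => // j _ /=; have := tail' 0%N j (leq0n j).
  by have := cnorm_lerB (u j) (u 0%N); rewrite expr0; lra.
move=> z [_ zu]; exists z => k; rewrite leNgt; apply/negP => kz.
have [|| y [/= y1 y2]] := zu [set y | cnorm (y - u k) <= 2 * K * 2^-1 ^+ k]
    [set y | cnorm (y - z) < cnorm (u k - z) - 2 * K * 2^-1 ^+ k].
- by exists k => // j /= kj; exact: tail'.
- apply/nbhs_cnormP; exists (cnorm (u k - z) - 2 * K * 2^-1 ^+ k); first by lra.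
  by [].
- by have := cnorm_distD y (u k) z; rewrite (cnormB (u k) y); lra.
Qed.

Lemma quadratically_convergentP (u : nat -> C) z (A M : R) :
  (forall j, cnorm (u j - z) <= A * 2^-1 ^+ j) ->
  (forall j, cnorm (u j.+1 - z) <= M * cnorm (u j - z) ^+ 2) ->
  quadratically_convergent u z.
Proof.
move=> uA uM; split; last first.
  by exists M => j; rewrite !cnormE -rmorphXn -rmorphM /= lecR.
apply/cvg_cnormP => e e0.
have : A * 2^-1 ^+ j @[j --> \oo] --> A * 0.
  by apply: cvgMr; apply: cvg_expr; rewrite ger0_norm //; lra.
rewrite mulr0 => /cvgr0_norm_lt /(_ e e0); apply: filterS => j.
by move/(le_lt_trans (ler_norm _)); apply: le_lt_trans.
Qed.

Record newton_setting (D : set C) (f f' : C -> C) (M m r : R) (z0 : C) : Prop :=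
  NewtonSetting {
  ns_quad : quad_diff D f f' M;
  ns_m_gt0 : 0 < m;
  ns_disc : forall x, cnorm (x - z0) < r -> D x;
  ns_deriv : m <= cnorm (f' z0);
  ns_radius : 8 * M * r <= m }.

Lemma derivative_lower_bound (D : set C) (f f' : C -> C) (M m r : R) (z0 : C) x :
  newton_setting D f f' M m r z0 ->
  cnorm (x - z0) < r -> m / 2 <= cnorm (f' x).
Proof.
move=> ns xr; have [fD m0 rD mz0 Mr] := ns.
have Dz0 : D z0 by apply: rD; rewrite subrr cnorm0 (le_lt_trans _ xr) ?cnorm_ge0.
have M0 := qd_gt0 fD.
have := quad_diff_lip' fD (rD _ xr) Dz0.
have := cnorm_lerB (f' z0) (f' x); rewrite (cnormB (f' z0)).
have : M * cnorm (x - z0) <= M * r by rewrite ler_pM2l // ltW.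
lra.
Qed.

Lemma derivative_neq0 (D : set C) (f f' : C -> C) (M m r : R) (z0 : C) x :
  newton_setting D f f' M m r z0 -> cnorm (x - z0) < r -> f' x != 0.
Proof.
move=> ns xr; rewrite -cnorm_gt0.
apply: lt_le_trans (derivative_lower_bound ns xr).
by rewrite divr_gt0 // (ns_m_gt0 ns).
Qed.

Lemma injective_near (D : set C) (f f' : C -> C) (M m r : R) (z0 : C) x y :
  newton_setting D f f' M m r z0 ->
  cnorm (x - z0) < r -> cnorm (y - z0) < r ->
  f x = f y -> x = y.
Proof.
move=> ns xr yr fxy; have [fD m0 rD mz0 Mr] := ns.
apply/eqP; rewrite -subr_eq0 -cnorm_eq0; apply/negP => /negP n0.
have c0 : 0 < cnorm (x - y) by rewrite lt0r n0 cnorm_ge0.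
have M0 := qd_gt0 fD.
have := qd_quad fD (rD _ xr) (rD _ yr).
rewrite fxy subrr sub0r cnormN cnormM expr2 mulrA ler_pM2r //.
have : M * cnorm (x - y) <= M * (2 * r).
  rewrite ler_pM2l //.
  by have := cnorm_distD z0 x y; rewrite (cnormB z0 y); lra.
have := derivative_lower_bound ns yr; lra.
Qed.

Lemma newton_step (D : set C) (f f' : C -> C) (M m r : R) (z0 : C) w g x :
  newton_setting D f f' M m r z0 ->
  (forall x, cnorm (x - z0) < r -> g x = x - (f x - w) / f' x) ->
  cnorm (x - z0) < r ->
  cnorm (g x - x) * (m / 2) <= cnorm (f x - w).
Proof.
move=> ns gE xr; have [fD m0 rD mz0 Mr] := ns.
have mx := derivative_lower_bound ns xr.
have f0 := derivative_neq0 ns xr.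
have -> : f x - w = - ((g x - x) * f' x) by rewrite gE //; field.
by rewrite cnormN cnormM ler_wpM2l ?cnorm_ge0.
Qed.

Lemma newton_residual (D : set C) (f f' : C -> C) (M m r : R) (z0 : C) w g x :
  newton_setting D f f' M m r z0 ->
  (forall x, cnorm (x - z0) < r -> g x = x - (f x - w) / f' x) ->
  cnorm (x - z0) < r -> cnorm (g x - z0) < r ->
  cnorm (f (g x) - w) <= M * cnorm (g x - x) ^+ 2.
Proof.
move=> ns gE xr gxr; have [fD m0 rD mz0 Mr] := ns.
have mx := derivative_lower_bound ns xr.
have f0 := derivative_neq0 ns xr.
have -> : f (g x) - w = f (g x) - f x - f' x * (g x - x).
  by rewrite {3}gE //; field.
exact: (qd_quad fD) (rD _ gxr) (rD _ xr).
Qed.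

Lemma newton_error (D : set C) (f f' : C -> C) (M m r : R) (z0 : C) w g z x :
  newton_setting D f f' M m r z0 ->
  (forall x, cnorm (x - z0) < r -> g x = x - (f x - w) / f' x) ->
  cnorm (x - z0) < r -> cnorm (z - z0) < r -> f z = w ->
  cnorm (g x - z) <= 2 * M / m * cnorm (x - z) ^+ 2.
Proof.
move=> ns gE xr zr fz; have [fD m0 rD mz0 Mr] := ns.
have mx := derivative_lower_bound ns xr.
have f0 := derivative_neq0 ns xr.
have q := qd_quad fD (rD _ zr) (rD _ xr); rewrite (cnormB z) in q.
have E : f z - f x - f' x * (z - x) = (g x - z) * f' x.
  by rewrite gE // fz; field.
rewrite E cnormM in q.
rewrite -(ler_pM2r (_ : 0 < m / 2)) ?divr_gt0 //.
apply: le_trans (_ : cnorm (g x - z) * cnorm (f' x) <= _).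
  by rewrite ler_wpM2l ?cnorm_ge0.
apply: le_trans q _; rewrite le_eqVlt; apply/orP; left; apply/eqP; field.
by rewrite gt_eqF.
Qed.

Lemma newton_iterates (D : set C) (f f' : C -> C) (M m r : R) (z0 : C) w g :
  newton_setting D f f' M m r z0 ->
  (forall x, cnorm (x - z0) < r -> g x = x - (f x - w) / f' x) ->
  4 * cnorm (f z0 - w) < m * r -> 8 * M * cnorm (f z0 - w) <= m ^+ 2 ->
  let e := cnorm (f z0 - w) in let u j := iter j g z0 in forall j,
  cnorm (u j - z0) * m <= 4 * e * (1 - 2^-1 ^+ j) /\
  cnorm (f (u j) - w) <= e * 2^-1 ^+ j.
Proof.
move=> ns gE e_r e_M e u; have [fD m0 rD mz0 Mr] := ns.
have e0 : 0 <= e by exact: cnorm_ge0.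
have M0 := qd_gt0 fD.
have in_r j' : cnorm (u j' - z0) * m <= 4 * e * (1 - 2^-1 ^+ j') ->
    cnorm (u j' - z0) < r.
  move=> h; rewrite -(ltr_pM2r m0) (mulrC r); apply: le_lt_trans h _.
  apply: le_lt_trans e_r; rewrite -/e.
  have : 0 <= e * 2^-1 ^+ j' by rewrite mulr_ge0 ?exprn_ge0.
  lra.
elim=> [|j [IH1 IH2]]; first by rewrite /= subrr cnorm0 expr0; lra.
have ur := in_r _ IH1.
have st := newton_step ns gE ur; rewrite -/(u j.+1) in st.
set q := 2^-1 ^+ j in IH1 IH2 *.
have q0 : 0 <= q by rewrite exprn_ge0.
have q1 : q <= 1 by rewrite exprn_ile1 //; lra.
have B : cnorm (u j.+1 - z0) * m <= 4 * e * (1 - 2^-1 ^+ j.+1).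
  have := cnorm_distD (u j) (u j.+1) z0; rewrite -(ler_pM2r m0) exprS -/q.
  lra.
split=> //.
have /= := newton_residual ns gE ur (in_r _ B); rewrite -/(u j.+1) => res.
set ej := cnorm (f (u j) - w) in IH2 st; set d := cnorm _ in st res.
have ej0 : 0 <= ej by exact: cnorm_ge0.
have d0 : 0 <= d by exact: cnorm_ge0.
have ee : ej <= e by apply: le_trans IH2 _; rewrite ler_piMr.
have : M * d ^+ 2 <= ej / 2; last by rewrite (exprS _ j) -/q; lra.
have m2 : 0 < (m / 2) ^+ 2 by rewrite exprn_gt0 ?divr_gt0.
rewrite -(ler_pM2r m2).
have : M * (d * (m / 2)) ^+ 2 <= M * (ej * ej).
  by rewrite ler_pM2l // -expr2 ler_pXn2r // nnegrE mulr_ge0 // ltW // divr_gt0.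
have : M * (ej * ej) <= M * (e * ej) by rewrite ler_pM2l // ler_wpM2r.
have : 8 * M * e * ej <= m ^+ 2 * ej by rewrite ler_wpM2r.
lra.
Qed.

Lemma newton_convergence (D : set C) (f f' : C -> C) (M m r : R) (z0 : C) w g :
  newton_setting D f f' M m r z0 ->
  (forall x, cnorm (x - z0) < r -> g x = x - (f x - w) / f' x) ->
  4 * cnorm (f z0 - w) < m * r -> 8 * M * cnorm (f z0 - w) <= m ^+ 2 ->
  let u j := iter j g z0 in
  exists z, [/\ cnorm (z - z0) < r, f z = w,
    forall j, cnorm (u j - z0) < r & quadratically_convergent u z].
Proof.
move=> ns gE e_r e_M u; have [fD m0 rD mz0 Mr] := ns.
set e := cnorm (f z0 - w) in e_r e_M.
have e0 : 0 <= e by exact: cnorm_ge0.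
have M0 := qd_gt0 fD.
have er : 4 * e / m < r by rewrite ltr_pdivrMr // (mulrC r).
have ub j : cnorm (u j - z0) <= 4 * e / m.
  rewrite ler_pdivlMr //; apply: le_trans (newton_iterates ns gE e_r e_M j).1 _.
  by rewrite ler_piMr ?mulr_ge0 // gerBl exprn_ge0.
have ur j : cnorm (u j - z0) < r by exact: le_lt_trans (ub j) er.
have [] := @geometric_cauchy u (2 * e / m).
  move=> j; have := newton_step ns gE (ur j).
  have := (newton_iterates ns gE e_r e_M j).2.
  rewrite -/(u j.+1) => h1 h2.
  rewrite mulrAC ler_pdivlMr //; lra.
move=> z uz; exists z.
have zr : cnorm (z - z0) < r.
  by have := uz 0%N; rewrite /u /= expr0 cnormB; move: er; lra.
have Q : f z = w.
  apply/eqP; rewrite -subr_eq0 -cnorm_eq0 eq_le cnorm_ge0 andbT.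
  apply/ler_addgt0Pr => t t0; rewrite add0r.
  pose L := M * (2 * (2 * e / m)) + e.
  have L0 : 0 <= L by rewrite addr_ge0 // !mulr_ge0 ?invr_ge0 // ltW.
  have fz j : cnorm (f z - w) <= L * 2^-1 ^+ j.
    have := cnorm_distD (f (u j)) (f z) w.
    have := (newton_iterates ns gE e_r e_M j).2.
    have := qd_lip fD (rD _ zr) (rD _ (ur j)); rewrite (cnormB z).
    by have := uz j; rewrite -(ler_pM2l M0) /L; lra.
  have : L * 2^-1 ^+ j @[j --> \oo] --> L * 0.
    by apply: cvgMr; apply: cvg_expr; rewrite ger0_norm //; lra.
  rewrite mulr0 => /cvgr0_norm_lt /(_ t t0) [k _ /(_ k (leqnn k))].
  move/(le_lt_trans (ler_norm _)) => h; apply: ltW; exact: le_lt_trans (fz k) h.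
split=> //.
apply: (@quadratically_convergentP _ _ (2 * (2 * e / m)) (2 * M / m)) => // j.
exact: newton_error ns gE _ _ _.
Qed.

End Newton.

Section Blaschke.
Context {R : realType}.
Local Notation C := (cplx R).

Lemma derivative_uniform_lower_bound (D Gamma : set C) (f f' : C -> C) (M : R) :
  quad_diff D f f' M -> closed Gamma -> (forall z, cnorm z <= 1 -> D z) ->
  (forall z, cnorm z <= 1 -> Gamma (f z) -> f' z != 0) ->
  exists2 m : R, 0 < m &
    forall z, cnorm z <= 1 -> Gamma (f z) -> m <= cnorm (f' z).
Proof.
move=> fD cG D1 f'0; have M0 := qd_gt0 fD.
pose P (m : R) (z : C) := cnorm z <= 1 -> Gamma (f z) -> m <= cnorm (f' z).
have /compact_near_coveringP cov := @compact_cdisc R 1.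
have H : \forall m \near 0^'+, [set z : C | cnorm z <= 1] `<=` P m.
  apply: cov => z /= z1.
  have [Gz|nGz] := pselect (Gamma (f z)).
    have d0 : 0 < cnorm (f' z) / 2.
      by rewrite divr_gt0 // cnorm_gt0; exact: f'0.
    exists ([set x | cnorm (x - z) < cnorm (f' z) / 2 / (2 * M)],
            [set m | m < cnorm (f' z) / 2]).
      split => /=; last exact: nbhs_right_lt.
      apply/nbhs_cnormP; exists (cnorm (f' z) / 2 / (2 * M)) => //.
      by rewrite divr_gt0 // mulr_gt0.
    move=> [x m] /= [xz mz] x1 _.
    have := quad_diff_lip' fD (D1 z z1) (D1 x x1).
    have := cnorm_lerB (f' z) (f' x).
    move: xz; rewrite ltr_pdivlMr ?mulr_gt0 // (cnormB z x); lra.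
  have [e e0 He] := closed_cnormP cG nGz.
  exists ([set x | cnorm (x - z) < e / M], setT).
    split => /=; last exact: filterT.
    by apply/nbhs_cnormP; exists (e / M) => //; rewrite divr_gt0.
  move=> [x m] /= [xz _] x1 /He[].
  apply: le_lt_trans (qd_lip fD (D1 x x1) (D1 z z1)) _.
  by move: xz; rewrite ltr_pdivlMr // mulrC.
have [m [m0 Hm]] := filter_ex (filterI (nbhs_right_gt (0 : R)) H).
by exists m => // z z1; exact: Hm.
Qed.

Lemma mobius_denom_ge (a z : C) (c : R) :
  0 < c -> cnorm a <= 1 - 2 * c -> cnorm z < 1 + c ->
  c <= cnorm (1 - a^* * z).
Proof.
move=> c0 ac zc; have := cnorm_lerB 1 (a^* * z).
rewrite cnorm1 cnormM cnorm_conj.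
have : cnorm a * cnorm z <= (1 - 2 * c) * (1 + c).
  by apply: ler_pM => //; rewrite ?cnorm_ge0 // ltW.
have : 0 <= c * c by rewrite mulr_ge0 // ltW.
lra.
Qed.

Lemma mobius_quad_diff (a : C) (c : R) : 0 < c -> cnorm a <= 1 - 2 * c ->
  exists f' M, quad_diff [set z | cnorm z < 1 + c]
    (fun z => (z - a) / (1 - a^* * z)) f' M.
Proof.
move=> c0 ac.
pose k : C := 1 - a^* * a.
pose q (z : C) := (1 - a^* * z)^-1.
have a0 := cnorm_ge0 a.
have qc z : cnorm z < 1 + c -> 1 - a^* * z != 0 /\ cnorm (q z) <= c^-1.
  move=> zc; have h := mobius_denom_ge c0 ac zc.
  have h0 : 0 < cnorm (1 - a^* * z) by exact: lt_le_trans h.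
  by split; [rewrite -cnorm_gt0|rewrite /q cnormV lef_pV2].
have k2 : cnorm k <= 2.
  have := cnorm_triangle 1 (- (a^* * a)); rewrite cnormN cnorm1 cnormM cnorm_conj.
  have : cnorm a * cnorm a <= 1 * 1 by apply: ler_pM => //; lra.
  by rewrite /k; lra.
have V1 : 1 <= c^-1 by rewrite invf_ge1 //; lra.
have V0 : 0 < c^-1 by rewrite invr_gt0.
set V := c^-1 in qc V1 V0.
have pm (u v : C) (s t : R) :
    cnorm u <= s -> cnorm v <= t -> cnorm (u * v) <= s * t.
  by move=> us vt; rewrite cnormM ler_pM ?cnorm_ge0.
have V2 : V <= V ^+ 2 by rewrite expr2 ler_peMl // ltW.
have V3 : V ^+ 2 <= V ^+ 3 by rewrite (exprS V 2) ler_peMl ?exprn_ge0 // ltW.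
exists (fun z => k * (q z * q z)), (4 * V ^+ 3).
have fB x y : cnorm x < 1 + c -> cnorm y < 1 + c ->
    (x - a) / (1 - a^* * x) - (y - a) / (1 - a^* * y) = k * (q x * q y) * (x - y).
  by move=> /qc[nx _] /qc[ny _]; rewrite /q /k; field; rewrite nx ny.
have kq x y : cnorm x < 1 + c -> cnorm y < 1 + c ->
    cnorm (k * (q x * q y)) <= 2 * (V * V).
  by move=> /qc[_ bx] /qc[_ by_]; apply: (pm) => //; exact: pm.
split => [|x /= xc|x /= xc|x y /= xc yc|x y /= xc yc].
- by rewrite mulr_gt0 // exprn_gt0.
- have : cnorm ((x - a) * q x) <= 3 * V.
    apply: pm; last by have [] := qc x xc.
    by have := cnorm_triangle x (- a); rewrite cnormN; lra.
  rewrite -/(q x); lra.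
- by have := kq x x xc xc; rewrite -expr2; lra.
- rewrite fB // cnormM; apply: ler_wpM2r; first exact: cnorm_ge0.
  by have := kq x y xc yc; rewrite -expr2; lra.
- rewrite fB //.
  have -> : k * (q x * q y) * (x - y) - k * (q y * q y) * (x - y) =
      (k * (q x * q y)) * (a^* * q y) * ((x - y) * (x - y)).
    have [nx _] := qc x xc; have [ny _] := qc y yc.
    by rewrite /q; field; rewrite nx ny.
  rewrite cnormM (cnormM (x - y)) -expr2.
  apply: ler_wpM2r; first by rewrite exprn_ge0 ?cnorm_ge0.
  have : cnorm (k * (q x * q y) * (a^* * q y)) <= 2 * (V * V) * (1 * V).
    apply: (pm); first exact: kq.
    by apply: pm; [rewrite cnorm_conj; lra|have [] := qc y yc].
  have : 0 <= V ^+ 3 by rewrite exprn_ge0 // ltW.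
  by rewrite !exprS expr0; lra.
Qed.

Lemma mobius_norm_gt1 (a z : C) : cnorm a < 1 -> 1 < cnorm z ->
  1 - a^* * z != 0 -> 1 < cnorm ((z - a) / (1 - a^* * z)).
Proof.
move=> a1 z1 nz.
have E : cnorm (z - a) ^+ 2 - cnorm (1 - a^* * z) ^+ 2 =
    (cnorm z ^+ 2 - 1) * (1 - cnorm a ^+ 2).
  have EC : `|z - a| ^+ 2 - `|1 - a^* * z| ^+ 2 =
      (`|z| ^+ 2 - 1) * (1 - `|a| ^+ 2).
    by rewrite !normCK !rmorphB rmorph1 rmorphM /= conjCK; ring.
  apply: complexI; rewrite !(rmorphB, rmorphM, rmorphXn, rmorph1) /= -!cnormE.
  exact: EC.
have n0 : 0 < cnorm (1 - a^* * z) by rewrite cnorm_gt0.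
rewrite cnormM cnormV ltr_pdivlMr // mul1r.
rewrite -(ltr_pXn2r (_ : (0 < 2)%N)) ?nnegrE ?cnorm_ge0 // -subr_gt0 E.
rewrite mulr_gt0 ?subr_gt0 ?exprn_egt1 //.
by rewrite expr_lt1 ?cnorm_ge0.
Qed.

Lemma prod_norm_gt1 (n : nat) (F : 'I_n -> C) : (0 < n)%N ->
  (forall k, 1 < cnorm (F k)) -> 1 < cnorm (\prod_(k < n) F k).
Proof.
case: n F => // n F _ F1; rewrite big_ord_recl cnormM.
suff h : 1 <= cnorm (\prod_(i < n) F (lift ord0 i)).
  by apply: lt_le_trans (F1 ord0) _; rewrite ler_peMr ?cnorm_ge0.
elim/big_ind: _ => [|x y x1 y1|i _]; first by rewrite cnorm1.
  by rewrite cnormM mulr_ege1.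
exact: ltW.
Qed.

Lemma uniform_radius (n : nat) (a : 'I_n -> C) : (forall k, cnorm (a k) < 1) ->
  exists2 c : R, 0 < c & forall k, cnorm (a k) <= 1 - 2 * c.
Proof.
move=> a1; pose mu := \big[Num.max/0]_k cnorm (a k).
have mu1 : mu < 1 by apply: bigmax_lt.
exists ((1 - mu) / 2); first by lra.
by move=> k; have : cnorm (a k) <= mu by [exact: le_bigmax]; lra.
Qed.

Lemma blaschke_quad_diff (n : nat) (a : 'I_n -> C) (eps : C) (c : R) :
  0 < c -> (forall k, cnorm (a k) <= 1 - 2 * c) ->
  exists f' M, quad_diff [set z | cnorm z < 1 + c] (blaschke a eps) f' M.
Proof.
move=> c0 ac.
have [g' [N gN]] := @quad_diff_cst R [set z | cnorm z < 1 + c] eps.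
have [h' [L hL]] := quad_diff_prod (index_enum 'I_n)
  (fun k => mobius_quad_diff c0 (ac k)).
by have := quad_diffM gN hL; do 2 eexists; eassumption.
Qed.

End Blaschke.

Theorem theorem3 (R : realType) (n : nat) (a : 'I_n -> cplx R) (eps : cplx R)
    (Gamma : set (cplx R))
    (n_ge1 : (1 <= n)%N)
    (a_in_D : forall k, `|a k| < 1)
    (eps_in_T : `|eps| = 1)
    (Gamma_curve : simple_smooth_curve Gamma)
    (Gamma_sub : Gamma `<=` pole_free_disc a)
    (Gamma_K : Gamma `&` critical_values a eps = set0) :
  exists r0 r1 : R, [/\ 0 < r0, 0 < r1 &
    forall z0 w0 : cplx R,
      blaschke a eps z0 = w0 -> `|z0| <= 1 -> Gamma w0 ->
      (* the Newton map is defined on the whole of [disc z0 r0] *)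
      (forall zeta, disc z0 r0 zeta ->
         pole_free a zeta /\ derive1 (blaschke a eps) zeta != 0) /\
      (forall w, disc w0 r1 w -> Gamma w ->
         exists z,
           [/\ disc z0 r0 z,
               (* necessarily [1 < `|z|] when [1 < `|w|] *)
               `|w| <= 1 -> `|z| <= 1,
               blaschke a eps z = w,
               forall z', disc z0 r0 z' -> blaschke a eps z' = w -> z' = z &
               (forall j, disc z0 r0 (iter j (newton a eps w) z0)) /\
               quadratically_convergent
                 (fun j => iter j (newton a eps w) z0) z])].
Proof.
have le1E (x : cplx R) : (`|x| <= 1) = (cnorm x <= 1).
  by rewrite cnormE -[1 in LHS]/((1 : R)%:C%C) lecR.
have a1 k : cnorm (a k) < 1.
  by rewrite -ltcR -cnormE; exact: a_in_D.
have [c c0 ac] := uniform_radius a1.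
pose D : set (cplx R) := [set z | cnorm z < 1 + c].
have [f' [M fD]] := blaschke_quad_diff eps c0 ac; rewrite -/D in fD.
set f := blaschke a eps in fD *.
have M0 := qd_gt0 fD.
have pf z : D z -> pole_free a z.
  move=> Dz k; rewrite -cnorm_gt0.
  exact: lt_le_trans c0 (mobius_denom_ge c0 (ac k) Dz).
have dE z : D z -> derive1 f z = f' z.
  move=> Dz; apply: quad_diff_derive1 fD _.
  apply/nbhs_cnormP; exists (1 + c - cnorm z); first by rewrite subr_gt0.
  by move=> y; have := cnorm_lerB y z; rewrite /D /=; lra.
have D1 z : cnorm z <= 1 -> D z by rewrite /D /=; lra.
have [m m0 mE] : exists2 m : R, 0 < m &
    forall z, cnorm z <= 1 -> Gamma (f z) -> m <= cnorm (f' z).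
  apply: (derivative_uniform_lower_bound fD _ D1).
    exact: simple_smooth_curve_closed.
  move=> z z1 Gz; apply/eqP => f'z.
  have : (Gamma `&` critical_values a eps) (f z).
    split=> //; exists z => //; split; first exact/pf/D1.
    by rewrite -/f dE //; exact: D1.
  by rewrite Gamma_K.
pose r0 := Num.min c (m / (8 * M)).
pose r1 := Num.min (m * r0 / 4) (m ^+ 2 / (8 * M)).
have M8 : 0 < 8 * M by exact: mulr_gt0.
have r00 : 0 < r0 by rewrite lt_min c0 divr_gt0.
have r10 : 0 < r1 by rewrite lt_min !divr_gt0 ?mulr_gt0 ?exprn_gt0.
have r0c : r0 <= c by rewrite ge_min lexx.
have r0m : 8 * M * r0 <= m.
  by rewrite mulrC -ler_pdivlMr // ge_min lexx orbT.
have r1m : 4 * r1 <= m * r0.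
  have : r1 <= m * r0 / 4 by rewrite ge_min lexx.
  by lra.
have r1M : 8 * M * r1 <= m ^+ 2.
  by rewrite mulrC -ler_pdivlMr // ge_min lexx orbT.
exists r0, r1; split => // z0 w0 fz0 z01 Gw0; rewrite le1E in z01.
have rD x : cnorm (x - z0) < r0 -> D x.
  by have := cnorm_lerB x z0; rewrite /D /=; lra.
have ns : newton_setting D f f' M m r0 z0.
  by split => //; apply: mE => //; rewrite fz0.
split.
  move=> x /disc_cnorm xr; split; first exact/pf/rD.
  rewrite -/f dE; last exact: rD.
  exact: derivative_neq0 ns xr.
move=> w /disc_cnorm ww0 Gw.
have gE x : cnorm (x - z0) < r0 -> newton a eps w x = x - (f x - w) / f' x.
  by move=> xr; rewrite /newton -/f dE //; exact: rD.
have ew : cnorm (f z0 - w) < r1 by rewrite fz0 cnormB.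
have e1 : 4 * cnorm (f z0 - w) < m * r0 by lra.
have e2 : 8 * M * cnorm (f z0 - w) <= m ^+ 2.
  by apply: le_trans r1M; rewrite ler_pM2l // ltW.
have [z [zr fz ur uz]] := newton_convergence ns gE e1 e2.
exists z; split => //; first exact/disc_cnorm.
- rewrite !le1E => w1; rewrite leNgt; apply/negP => z1.
  suff : 1 < cnorm w by rewrite ltNge w1.
  rewrite -fz /f /blaschke cnormM.
  have -> : cnorm eps = 1 by apply: complexI; rewrite -cnormE.
  rewrite mul1r; apply: prod_norm_gt1 => // k.
  by apply: mobius_norm_gt1 => //; exact: (pf z (rD z zr)).
- by move=> z' /disc_cnorm zr' fz'; apply: (injective_near ns zr' zr); rewrite fz.
- by split => // j; apply/disc_cnorm.
Qed.
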